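(* For any formulas $\phi$ and $\psi$ in the language of $\mathbf{PT}^+$: if $\psi\models\phi$ then $\psi\vdash\phi$ in the natural deduction system of $\mathbf{PT}^+$. In particular, if $\models\phi$ then $\vdash\phi$.
   Context: Formulas of $\mathbf{PT}^+$: $\phi::=p_i\mid\neg p_i\mid\bot\mid\mathrm{NE}\mid\phi\wedge\phi\mid\phi\otimes\phi\mid\phi\vee\phi$ ($i\in\mathbb N$). A valuation is $s:\mathbb N\to\{0,1\}$, a team a set of valuations. Semantics: $X\models p_i$ iff $s(i)=1$ for all $s\in X$; $X\models\neg p_i$ iff $s(i)=0$ for all $s\in X$; $X\models\bot$ iff $X=\emptyset$; $X\models\mathrm{NE}$ iff $X\ne\emptyset$; $\wedge$ as usual; $X\models\phi\otimes\psi$ iff $X=Y\cup Z$ for some $Y,Z\subseteq X$ with $Y\models\phi$, $Z\models\psi$; $X\models\phi\vee\psi$ iff $X\models\phi$ or $X\models\psi$. $\psi\models\phi$: every team satisfying $\psi$ satisfies $\phi$; $\models\phi$: every team satisfies $\phi$. Classical formulas: built from $p_i,\neg p_i,\bot$ by $\wedge,\otimes$. $p_i^1=p_i$, $p_i^0=\neg p_i$; empty $\otimes$-disjunction is $\bot$, empty $\vee$-disjunction is $\bot\wedge\mathrm{NE}$; for a team $X$ on finite $\{i_1,\dots,i_n\}$, $\Theta^*_X=\bigotimes_{s\in X}(p_{i_1}^{s(i_1)}\wedge\dots\wedge p_{i_n}^{s(i_n)}\wedge\mathrm{NE})$. Natural deduction system of $\mathbf{PT}^+$ ($\Gamma\vdash\phi$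 iff some derivation of $\phi$ has undischarged assumptions in $\Gamma$; metavariables range over all formulas, axioms are the specific formulas shown, no substitution rule). Axioms: $p_i\otimes\neg p_i$ (each $i$); $\bot\vee\mathrm{NE}$. Rules: standard $\wedge$-introduction/elimination; $\vee$-introduction (from $\phi$ infer $\phi\vee\psi$ and $\psi\vee\phi$) and $\vee$-elimination (from $\phi\vee\psi$, a derivation of $\chi$ from $\phi$ and one from $\psi$, infer $\chi$, discharging $\phi,\psi$); from $\phi$ infer $\phi\otimes\psi$ provided $\psi$ does not contain $\mathrm{NE}$; from $\phi$ infer $\phi\otimes\phi$; from $\phi\otimes\psi$, a derivation of $\alpha$ from $\phi$ and one of $\alpha$ from $\psi$, infer $\alpha$ (discharging $\phi,\psi$), provided $\alpha$ is classical and the other undischarged assumptions of both subderivations are classical; from $\phi\otimes\psi$ and a derivation of $\chi$ from $\psi$ (discharged) infer $\phi\otimes\chi$, provided the other undischarged assumptions of that subderivation are classical; from $\phi\otimes\psi$ infer $\psi\otimes\phi$; from $\phi\otimes(\psi\otimes\chi)$ infer $(\phi\otimes\psi)\otimes\chi$; from $p_i\wedge\neg p_i$ infer $\bot$; from $\phi\otimes\bot$ infer $\phi$; from $\bot\wedge\mathrm{NE}$ infer any $\phi$; from $\phi\otimes(\bot\wedge\mathrm{NE})$ infer $\bot\wedge\mathrm{NE}$; from $\Theta^*_X\wedge\Theta^*_Y$ infer $\bot\wedge\mathrm{NE}$ whenever $X,Y$ are distinct teams on the same finite index set; from $\phi\otimes(\psi\vee\chi)$ infer $(\phi\otimes\psi)\vee(\phi\otimes\chi)$;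 from $\mathrm{NE}\wedge\bigotimes_{i\in I}\phi_i$ ($I$ finite) infer $\bigvee_{\emptyset\ne J\subseteq I}\bigotimes_{i\in J}(\mathrm{NE}\wedge\phi_i)$. *)

(* Defs.v *)
From mathcomp Require Import all_boot finmap classical_sets.

Set Implicit Arguments.
Unset Strict Implicit.
Unset Printing Implicit Defensive.

Local Open Scope classical_set_scope.

Inductive form : Type :=
| Var of nat
| NegVar of nat
| Bot
| NE
| And of form & form
| Tens of form & form
| Or of form & form.

Definition valuation := nat -> bool.
Definition team := set valuation.

Fixpoint sat (X : team) (phi : form) : Prop :=
  match phi with
  | Var i => forall s, X s -> s i = true
  | NegVar i => forall s, X s -> s i = false
  | Bot => X = set0
  | NE => X <> set0
  | And phi psi => sat X phi /\ sat X psi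
  | Tens phi psi => exists Y Z : team,
      [/\ Y `<=` X, Z `<=` X, X = Y `|` Z, sat Y phi & sat Z psi]
  | Or phi psi => sat X phi \/ sat X psi
  end.

Definition entails (psi phi : form) : Prop :=
  forall X : team, sat X psi -> sat X phi.

Definition valid (phi : form) : Prop := forall X : team, sat X phi.

Fixpoint classical (phi : form) : bool :=
  match phi with
  | Var _ | NegVar _ | Bot => true
  | NE | Or _ _ => false
  | And phi psi | Tens phi psi => classical phi && classical psi
  end.

Fixpoint NE_free (phi : form) : bool :=
  match phi with
  | NE => false
  | Var _ | NegVar _ | Bot => true
  | And phi psi | Tens phi psi | Or phi psi => NE_free phi && NE_free psi
  end.

Definition BotNE : form := And Bot NE.

(* Iterated connectives are nested to the right; the unit appears only for
   the empty sequence. *)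
Fixpoint bigTens (l : seq form) : form :=
  match l with
  | [::] => Bot
  | [:: phi] => phi
  | phi :: l' => Tens phi (bigTens l')
  end.

Fixpoint bigOr (l : seq form) : form :=
  match l with
  | [::] => BotNE
  | [:: phi] => phi
  | phi :: l' => Or phi (bigOr l')
  end.

Definition lit (i : nat) (b : bool) : form := if b then Var i else NegVar i.

Definition conjNE (N : {fset nat}) (s : {ffun N -> bool}) : form :=
  foldr And NE [seq lit (val i) (s i) | i : N].

(* A team on the finite index set N is a set of functions from N to {0,1}. *)
Definition Theta (N : {fset nat}) (X : {set {ffun N -> bool}}) : form :=
  bigTens [seq conjNE s | s <- enum X].

(* deriv A phi: there is a derivation of phi whose set of undischarged
   assumptions is exactly A.  Discharging phi removes it from that set. *)
Inductive deriv : set form -> form -> Prop :=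
| D_assume phi :
    deriv [set phi] phi
| D_exclmid i :
    deriv set0 (Tens (Var i) (NegVar i))
| D_BotorNE :
    deriv set0 (Or Bot NE)
| D_andI A B phi psi :
    deriv A phi -> deriv B psi -> deriv (A `|` B) (And phi psi)
| D_andEl A phi psi :
    deriv A (And phi psi) -> deriv A phi
| D_andEr A phi psi :
    deriv A (And phi psi) -> deriv A psi
| D_orIl A phi psi :
    deriv A phi -> deriv A (Or phi psi)
| D_orIr A phi psi :
    deriv A phi -> deriv A (Or psi phi)
| D_orE A B C phi psi chi :
    deriv A (Or phi psi) -> deriv B chi -> deriv C chi ->
    deriv (A `|` (B `\ phi) `|` (C `\ psi)) chi
| D_tensI A phi psi :
    NE_free psi -> deriv A phi -> deriv A (Tens phi psi)
| D_tensdup A phi :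
    deriv A phi -> deriv A (Tens phi phi)
| D_tensE A B C phi psi alpha :
    classical alpha ->
    (forall beta, (B `\ phi) beta -> classical beta) ->
    (forall beta, (C `\ psi) beta -> classical beta) ->
    deriv A (Tens phi psi) -> deriv B alpha -> deriv C alpha ->
    deriv (A `|` (B `\ phi) `|` (C `\ psi)) alpha
| D_tenssub A B phi psi chi :
    (forall beta, (B `\ psi) beta -> classical beta) ->
    deriv A (Tens phi psi) -> deriv B chi ->
    deriv (A `|` (B `\ psi)) (Tens phi chi)
| D_tensC A phi psi :
    deriv A (Tens phi psi) -> deriv A (Tens psi phi)
| D_tensA A phi psi chi :
    deriv A (Tens phi (Tens psi chi)) -> deriv A (Tens (Tens phi psi) chi)
| D_contra A i :
    deriv A (And (Var i) (NegVar i)) -> deriv A Bot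
| D_tensBot A phi :
    deriv A (Tens phi Bot) -> deriv A phi
| D_exfalso A phi :
    deriv A BotNE -> deriv A phi
| D_tensBotNE A phi :
    deriv A (Tens phi BotNE) -> deriv A BotNE
| D_Theta A (N : {fset nat}) (X Y : {set {ffun N -> bool}}) :
    X <> Y -> deriv A (And (Theta X) (Theta Y)) -> deriv A BotNE
| D_tensOr A phi psi chi :
    deriv A (Tens phi (Or psi chi)) ->
    deriv A (Or (Tens phi psi) (Tens phi chi))
| D_NEtens A (I : finType) (phi : I -> form) :
    deriv A (And NE (bigTens [seq phi i | i : I])) ->
    deriv A (bigOr [seq bigTens [seq And NE (phi i) | i in J]
                   | J : {set I} in [pred J : {set I} | J != finset.set0]]).

Definition derivable (Gamma : set form) (phi : form) : Prop :=
  exists A : set form, A `<=` Gamma /\ deriv A phi.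

(* Main.v *)
Require Import Defs.
From mathcomp Require Import all_boot finmap boolp classical_sets.
From Stdlib Require Import Morphisms.

Set Implicit Arguments.
Unset Strict Implicit.
Unset Printing Implicit Defensive.

Local Open Scope classical_set_scope.

(** Fix a finite index set [N] containing the variables at hand.  Every team is
    described by exactly one of the formulas [Theta X], and their disjunction is
    provable: excluded middle gives the tensor of all complete conjunctions of
    literals, and the NE-distribution rule then selects the nonempty ones.
    If [X] satisfies [phi] then [Theta X] proves [phi], and conversely [phi]
    proves the disjunction of the [Theta X] with [X] satisfying [phi]; both are
    inductions on [phi] in which the tensor is handled by reading [Theta] as a
    sum over a set, since complete conjunctions with NE are tensor-idempotent.
    An entailment then holds disjunct by disjunct. *)

Definition classical_ctx (Gamma : set form) : Prop :=
  forall beta, Gamma beta -> classical beta.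

Definition proves (phi psi : form) : Prop := derivable [set phi] psi.

Definition interderivable (phi psi : form) : Prop :=
  proves phi psi /\ proves psi phi.

(** * Sequent-style rules *)

Section Sequents.
Implicit Types (G D : set form) (phi psi chi : form).

Lemma derivable_weak G D phi : G `<=` D -> derivable G phi -> derivable D phi.
Proof. by move=> GD [A [AG dA]]; exists A; split=> //; exact: subset_trans GD. Qed.

Lemma derivable_weakr G phi psi : proves phi psi -> derivable (G `|` [set phi]) psi.
Proof. by apply: derivable_weak; exact: subsetUr. Qed.

Lemma derivable_ax G phi : G phi -> derivable G phi.
Proof. by move=> Gphi; exists [set phi]; split; [move=> _ -> | exact: D_assume]. Qed.

Lemma derivable_thm G phi : deriv set0 phi -> derivable G phi.
Proof. by move=> d; exists set0; split. Qed.

(** Lifts a one-premise rule without discharge to any context: such a rule keeps the exact set of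
    undischarged assumptions that [deriv] records. *)
Lemma derivable_map G phi psi :
  (forall A, deriv A phi -> deriv A psi) -> derivable G phi -> derivable G psi.
Proof. by move=> h [A [AG dA]]; exists A; split=> //; exact: h. Qed.

Lemma derivable_andI G phi psi :
  derivable G phi -> derivable G psi -> derivable G (And phi psi).
Proof.
move=> [A [AG dA]] [B [BG dB]]; exists (A `|` B); split; last exact: D_andI.
by move=> x [/AG|/BG].
Qed.

Lemma derivable_andEl G phi psi : derivable G (And phi psi) -> derivable G phi.
Proof. exact: derivable_map (fun A => @D_andEl A phi psi). Qed.

Lemma derivable_andEr G phi psi : derivable G (And phi psi) -> derivable G psi.
Proof. exact: derivable_map (fun A => @D_andEr A phi psi). Qed.

Lemma derivable_orE G phi psi chi : derivable G (Or phi psi) ->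
  derivable (G `|` [set phi]) chi -> derivable (G `|` [set psi]) chi ->
  derivable G chi.
Proof.
move=> [A [AG dA]] [B [BG dB]] [C [CG dC]].
exists (A `|` (B `\ phi) `|` (C `\ psi)); split; last exact: D_orE dA dB dC.
by move=> x [[/AG//|[/BG[//|] h1 h2]]|[/CG[//|] h1 h2]]; case: h2.
Qed.

(** The language has no implication, so cut is obtained by eliminating [Or phi phi] with the same
    derivation in both branches. *)
Lemma derivable_cut G phi psi :
  derivable G phi -> derivable (G `|` [set phi]) psi -> derivable G psi.
Proof.
by move=> d h; apply: (derivable_orE _ h h); apply: derivable_map d => A; exact: D_orIl.
Qed.

Lemma derivable_proves G phi psi :
  proves phi psi -> derivable G phi -> derivable G psi.
Proof.
by move=> h d; apply: derivable_cut d _; exact: derivable_weakr.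
Qed.

Lemma derivable_exfalso G phi : derivable G BotNE -> derivable G phi.
Proof. exact: derivable_map (fun A => @D_exfalso A phi). Qed.

(** [D] isolates the classical part of the context that the two subderivations may use, while the
    tensor itself may depend on all of [G]. *)
Lemma derivable_tensE G D phi psi alpha :
  classical alpha -> classical_ctx D -> D `<=` G ->
  derivable G (Tens phi psi) ->
  derivable (D `|` [set phi]) alpha -> derivable (D `|` [set psi]) alpha ->
  derivable G alpha.
Proof.
move=> ca cD DG [A [AG dA]] [B [BD dB]] [C [CD dC]].
have sB x : (B `\ phi) x -> D x by case=> /BD[//|] h1 h2; case: h2.
have sC x : (C `\ psi) x -> D x by case=> /CD[//|] h1 h2; case: h2.
exists (A `|` (B `\ phi) `|` (C `\ psi)); split.
  by move=> x [[/AG//|/sB/DG//]|/sC/DG].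
by apply: D_tensE dA dB dC => // b; [move/sB|move/sC] => /cD.
Qed.

Lemma derivable_tens_sub G D phi psi chi :
  classical_ctx D -> D `<=` G ->
  derivable G (Tens phi psi) -> derivable (D `|` [set psi]) chi ->
  derivable G (Tens phi chi).
Proof.
move=> cD DG [A [AG dA]] [B [BD dB]].
have sB x : (B `\ psi) x -> D x by case=> /BD[//|] h1 h2; case: h2.
exists (A `|` (B `\ psi)); split; first by move=> x [/AG//|/sB/DG].
by apply: D_tenssub dA dB => b /sB /cD.
Qed.

Lemma derivable_tensC G phi psi : derivable G (Tens phi psi) -> derivable G (Tens psi phi).
Proof. exact: derivable_map (fun A => @D_tensC A phi psi). Qed.

Lemma derivable_Bot_NE G chi :
  derivable (G `|` [set Bot]) chi -> derivable (G `|` [set NE]) chi -> derivable G chi.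
Proof. by apply: derivable_orE; apply: derivable_thm; exact: D_BotorNE. Qed.

Lemma proves_refl phi : proves phi phi.
Proof. exact: derivable_ax. Qed.

Lemma proves_trans phi psi chi : proves phi psi -> proves psi chi -> proves phi chi.
Proof. by move=> h1 h2; exact: derivable_proves h2 h1. Qed.

(** The substitution rule acts on the right component only; the left one is reached by commuting. *)
Lemma proves_tens phi phi' psi psi' :
  proves phi phi' -> proves psi psi' -> proves (Tens phi psi) (Tens phi' psi').
Proof.
have sub a b b' : proves b b' -> proves (Tens a b) (Tens a b').
  move=> h; apply: (@derivable_tens_sub _ set0 a b) => //; first exact: derivable_ax.
  by rewrite set0U.
move=> h1 h2; apply: proves_trans (sub _ _ _ h2) _.
by apply/derivable_tensC/(derivable_proves (sub _ _ _ h1))/derivable_tensC/derivable_ax.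
Qed.

Lemma proves_Bot phi : NE_free phi -> proves Bot phi.
Proof.
move=> nf; apply: derivable_map (fun A => @D_tensBot A phi) _.
apply: derivable_tensC; apply: derivable_map (proves_refl Bot) => A; exact: D_tensI.
Qed.

(* [Bot] is classical, so it may be used inside a tensor component. *)
Lemma derivable_tens_NE G phi psi : proves phi NE ->
  derivable G (Tens phi psi) -> derivable G NE.
Proof.
move=> h d; apply: derivable_Bot_NE; last by apply: derivable_ax; right.
apply/derivable_exfalso/(derivable_map (fun A => @D_tensBotNE A psi)).
apply: (@derivable_tens_sub _ [set Bot] psi phi).
- by move=> _ ->.
- exact: subsetUr.
- apply/derivable_tensC/(derivable_weak _ d); exact: subsetUl.
apply: derivable_andI; first by apply: derivable_ax; left.
by apply: derivable_proves h _; apply: derivable_ax; right.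
Qed.

End Sequents.

#[local] Instance interderivable_equivalence : Equivalence interderivable.
Proof.
split.
- by move=> x; split; exact: proves_refl.
- by move=> x y [].
- by move=> x y z [a b] [c d]; split; [exact: proves_trans c | exact: proves_trans b].
Qed.

(** Congruence lets the laws of the tensor be applied by [rewrite] inside nested tensors. *)
#[local] Instance Tens_interderivable :
  Proper (interderivable ==> interderivable ==> interderivable) Tens.
Proof. by move=> a a' [h1 h2] b b' [h3 h4]; split; exact: proves_tens. Qed.

(** * Iterated connectives *)

Lemma interderivable_tensC a b : interderivable (Tens a b) (Tens b a).
Proof. by split; apply: derivable_tensC; exact: derivable_ax. Qed.

(** Only one direction is a rule; the other is its conjugate under commutativity. *)
Lemma interderivable_tensA a b c :
  interderivable (Tens a (Tens b c)) (Tens (Tens a b) c).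
Proof.
have h x y z : proves (Tens x (Tens y z)) (Tens (Tens x y) z).
  by apply: derivable_map (proves_refl _) => A; exact: D_tensA.
split=> //.
apply: proves_trans (interderivable_tensC _ _).1 _.
apply: proves_trans (proves_tens (proves_refl _) (interderivable_tensC _ _).1) _.
apply: proves_trans (h _ _ _) _.
apply: proves_trans (proves_tens (interderivable_tensC _ _).1 (proves_refl _)) _.
exact: (interderivable_tensC _ _).1.
Qed.

Lemma interderivable_tens_Bot a : interderivable (Tens a Bot) a.
Proof.
split; apply: derivable_map (proves_refl _) => A; first exact: D_tensBot.
exact: D_tensI.
Qed.

Lemma bigTens_cons a l : interderivable (bigTens (a :: l)) (Tens a (bigTens l)).
Proof. by case: l => [|b l] /=; rewrite ?interderivable_tens_Bot; reflexivity. Qed.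

Lemma bigTens_cat l m :
  interderivable (bigTens (l ++ m)) (Tens (bigTens l) (bigTens m)).
Proof.
elim: l => [|a l IH]; last first.
  by rewrite cat_cons !bigTens_cons IH interderivable_tensA; reflexivity.
by rewrite interderivable_tensC interderivable_tens_Bot; reflexivity.
Qed.

(** * Tensors of idempotent formulas as sums over sets *)

Section Idempotent.
Variables (T : eqType) (c : T -> form).
Hypothesis c_idem : forall x, interderivable (Tens (c x) (c x)) (c x).
Implicit Types l m : seq T.

Lemma bigTens_absorb x l : x \in l ->
  interderivable (Tens (c x) (bigTens (map c l))) (bigTens (map c l)).
Proof.
elim: l => // y l IH; rewrite inE map_cons bigTens_cons => /predU1P[<-|/IH e].
  by rewrite interderivable_tensA c_idem; reflexivity.
rewrite interderivable_tensA (interderivable_tensC (c x)) -interderivable_tensA e.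
reflexivity.
Qed.

Lemma bigTens_subset l m : {subset m <= l} ->
  interderivable (Tens (bigTens (map c l)) (bigTens (map c m))) (bigTens (map c l)).
Proof.
elim: m => [|x m IH] sml; first exact: interderivable_tens_Bot.
rewrite map_cons bigTens_cons (interderivable_tensC (c x)) interderivable_tensA IH.
  by rewrite interderivable_tensC; apply: bigTens_absorb; rewrite sml // mem_head.
by move=> y ym; apply: sml; rewrite inE ym orbT.
Qed.

(** Each list absorbs the other, so order and multiplicity of the components do not matter. *)
Lemma bigTens_eq_mem l m : l =i m ->
  interderivable (bigTens (map c l)) (bigTens (map c m)).
Proof.
move=> e; rewrite -(@bigTens_subset l m) => [|x]; last by rewrite e.
by rewrite interderivable_tensC; apply: bigTens_subset => x; rewrite e.
Qed.

End Idempotent.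

Lemma bigTensI (T : eqType) (c : T -> form) (x : T) (l : seq T) :
  (forall y, NE_free (c y)) -> x \in l -> proves (c x) (bigTens (map c l)).
Proof.
move=> nf; have nfl m : NE_free (bigTens (map c m)).
  by elim: m => [|y [|z m] IH] //=; rewrite nf.
have step a b : NE_free b -> proves a (Tens a b).
  by move=> h; apply: derivable_map (proves_refl a) => A; exact: D_tensI.
elim: l => // y l IH; rewrite inE map_cons => /predU1P[<-|/IH h];
  apply: proves_trans (bigTens_cons _ _).2; first exact: step.
apply: proves_trans h _; apply: derivable_tensC; exact: step.
Qed.

Lemma bigTensE (T : eqType) (c : T -> form) (l : seq T) (alpha : form) :
  classical alpha -> NE_free alpha -> (forall x, x \in l -> proves (c x) alpha) ->
  proves (bigTens (map c l)) alpha.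
Proof.
move=> ca nfa; elim: l => [|x l IH] h; first exact: proves_Bot.
apply: proves_trans (bigTens_cons _ _).1 _.
apply: (@derivable_tensE _ set0 (c x) (bigTens (map c l))) => //.
- exact: derivable_ax.
- by rewrite set0U; apply: h; exact: mem_head.
by rewrite set0U; apply: IH => y yl; apply: h; rewrite inE yl orbT.
Qed.

Lemma proves_bigTens (T : eqType) (c d : T -> form) (l : seq T) :
  (forall x, proves (c x) (d x)) -> proves (bigTens (map c l)) (bigTens (map d l)).
Proof.
move=> h; elim: l => [|x l IH]; first exact: proves_refl.
rewrite !map_cons; apply: proves_trans (bigTens_cons _ _).1 _.
by apply: proves_trans (bigTens_cons _ _).2; exact: proves_tens.
Qed.

Lemma bigOrI (T : eqType) (c : T -> form) (x : T) (l : seq T) :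
  x \in l -> proves (c x) (bigOr (map c l)).
Proof.
elim: l => // y [|z l] IH.
  by rewrite inE => /eqP->; exact: proves_refl.
rewrite inE => /predU1P[<-|/IH h] /=.
  by apply: derivable_map (proves_refl (c x)) => A; exact: D_orIl.
by apply: derivable_map h => A; exact: D_orIr.
Qed.

Lemma bigOrE (T : eqType) (c : T -> form) (l : seq T) G chi :
  derivable G (bigOr (map c l)) ->
  (forall x, x \in l -> derivable (G `|` [set c x]) chi) -> derivable G chi.
Proof.
elim: l G => [|y [|z l] IH] G /= d h.
- exact: derivable_exfalso.
- by apply: derivable_cut d _; apply: h; rewrite inE.
apply: derivable_orE d _ _; first by apply: h; exact: mem_head.
apply: IH => [|x xl]; first by apply: derivable_ax; right.
have := h x; rewrite inE xl orbT => /(_ isT) d; apply: derivable_weak d.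
by move=> w [Gw|->]; [left; left|right].
Qed.

(** The tensor distributes over a disjunction; for the empty one, [BotNE] as a component makes the
    whole tensor contradictory. *)
Lemma bigOr_tensE (T : eqType) (c : T -> form) (l : seq T) (a chi : form) :
  (forall x, x \in l -> proves (Tens a (c x)) chi) ->
  proves (Tens a (bigOr (map c l))) chi.
Proof.
elim: l => [|y [|z l] IH] h.
- apply/derivable_exfalso/(derivable_map (fun A => @D_tensBotNE A a)); exact: derivable_ax.
- by apply: h; rewrite inE.
apply: (@derivable_orE _ (Tens a (c y)) (Tens a (bigOr (map c (z :: l))))).
- by apply: derivable_map (proves_refl _) => A; exact: D_tensOr.
- apply: derivable_weakr; apply: h; exact: mem_head.
apply: derivable_weakr; apply: IH => x xl.
by apply: h; rewrite inE xl orbT.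
Qed.

Lemma derivable_foldr_And (T : eqType) (c : T -> form) G a (l : seq T) :
  derivable G (foldr And a (map c l)) <->
  derivable G a /\ (forall x, x \in l -> derivable G (c x)).
Proof.
split=> [|[da]]; elim: l => [|x l IH] //=.
- move=> d; have [da h] := IH (derivable_andEr d); split=> // y.
  by rewrite inE => /predU1P[->|/h//]; exact: derivable_andEl d.
- move=> h; apply: derivable_andI; first by apply: h; exact: mem_head.
  by apply: IH => y yl; apply: h; rewrite inE yl orbT.
Qed.

(** * Classical formulas and case distinction on literals *)

Lemma classical_NE_free phi : classical phi -> NE_free phi.
Proof. by elim: phi => //= a IHa b IHb /andP[/IHa-> /IHb->]. Qed.

Lemma classical_bigTens (T : eqType) (c : T -> form) (l : seq T) :
  (forall x, classical (c x)) -> classical (bigTens (map c l)).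
Proof. by move=> h; elim: l => [|y [|z l] IH] //=; rewrite h. Qed.

Lemma classical_lit i b : classical (lit i b).
Proof. by case: b. Qed.

(** Each index is decided by tensor elimination on its excluded-middle axiom. The literals
    accumulated in [G] are classical, so the side conditions persist through the induction. *)
Lemma derivable_literal_cases (alpha : form) (l : seq nat) (G : set form) :
  classical alpha -> classical_ctx G -> uniq l ->
  (forall v : nat -> bool,
     derivable (G `|` [set lit i (v i) | i in [set` l]]) alpha) ->
  derivable G alpha.
Proof.
move=> ca; elim: l G => [|i l IH] G cG /=.
  move=> _ /(_ xpredT) d; apply: derivable_weak d => x [//|[? /=]].
  by rewrite inE.
move=> /andP[il ul] h.
have step b : derivable (G `|` [set lit i b]) alpha.
  apply: IH => // [x [/cG//|->]|v]; first exact: classical_lit.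
  (* The assignment given by the induction is overridden at [i]; as [i] is not in [l], its values on
     [l] are unchanged. *)
  apply: derivable_weak (h (fun j => if j == i then b else v j)).
  move=> x [Gx|[j /=]]; first by left; left.
  rewrite inE => /predU1P[->|jl] <-; first by rewrite eqxx; left; right.
  rewrite ifN; last by apply: contraNneq il => <-.
  by right; exists j.
apply: (derivable_tensE ca cG (@subset_refl _ G) _ (step true) (step false)).
exact: derivable_thm (D_exclmid i).
Qed.

Fixpoint vars (phi : form) : {fset nat} :=
  match phi with
  | Var i | NegVar i => [fset i]%fset
  | Bot | NE => fset0
  | And a b | Tens a b | Or a b => (vars a `|` vars b)%fset
  end.

Lemma derivable_lits_contra i (G : set form) :
  derivable G (Var i) -> derivable G (NegVar i) -> derivable G Bot.
Proof.
move=> h1 h2; apply: derivable_map (derivable_andI h1 h2) => A; exact: D_contra.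
Qed.

Lemma sat_lit (T : team) i b : sat T (lit i b) <-> (forall s, T s -> s i = b).
Proof. by case: b. Qed.

(** * Teams on a finite index set *)

Section FiniteTeams.
Variable N : {fset nat}.
Implicit Types (f g : {ffun N -> bool}) (X Y Z : {set {ffun N -> bool}}).

(** The default [false] outside [N] fixes one full valuation for each function on [N]. *)
Definition extend f : valuation :=
  fun i => if insub i is Some j then f j else false.

Lemma extendE f (j : N) : extend f (val j) = f j.
Proof. by rewrite /extend valK. Qed.

Lemma extend_inj : injective extend.
Proof. by move=> f g e; apply/ffunP => j; rewrite -!extendE e. Qed.

Definition team_of X : team := [set extend f | f in [set` X]].

Lemma team_ofP X f : team_of X (extend f) <-> f \in X.
Proof. by split=> [[g /= gX /extend_inj <-]|fX] //; exists f. Qed.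

Lemma team_of_eq0 X : team_of X = set0 <-> X = finset.set0.
Proof.
split=> [e|->].
  apply/eqP; rewrite -finset.subset0; apply/fintype.subsetP => f /team_ofP.
  by rewrite e.
by apply/seteqP; split=> // s [f /=]; rewrite finset.inE.
Qed.

Lemma team_ofU X Y : team_of (X :|: Y) = team_of X `|` team_of Y.
Proof.
apply/seteqP; split=> [s [f /=]|s [] [f /= fX <-]].
- by rewrite finset.inE => /orP[fX|fY] <-; [left|right]; exists f.
- by exists f => //=; rewrite finset.inE fX.
- by exists f => //=; rewrite finset.inE fX orbT.
Qed.

(** Ensures that both parts of a semantic splitting of [team_of X] are again described by finite
    teams. *)
Lemma team_of_subset (X : {set {ffun N -> bool}}) (T : team) :
  T `<=` team_of X -> exists Y, team_of Y = T.
Proof.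
move=> TX; exists [set f in X | `[< T (extend f) >]]%SET.
apply/seteqP; split=> [s [f /=]|s Ts].
  by rewrite finset.inE => /andP[_ /asboolP ?] <-.
have [f /= fX e] := TX _ Ts; exists f => //=.
by rewrite finset.inE fX; apply/asboolP; rewrite e.
Qed.

Lemma conjNE_proves_NE f : proves (conjNE f) NE.
Proof.
by have [/(_ (proves_refl (conjNE f))) [h _] _] :=
  derivable_foldr_And (fun i : N => lit (val i) (f i)) [set conjNE f] NE (enum {: N}).
Qed.

Lemma conjNE_proves_lit f (i : N) : proves (conjNE f) (lit (val i) (f i)).
Proof.
have [/(_ (proves_refl (conjNE f))) [_ h] _] :=
  derivable_foldr_And (fun i : N => lit (val i) (f i)) [set conjNE f] NE (enum {: N}).
by apply: h; rewrite mem_enum.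
Qed.

(** Literals are classical and pass through tensor elimination, whereas [NE] is inherited from a
    single nonempty component. The converse is the duplication rule. *)
Lemma conjNE_idem f : interderivable (Tens (conjNE f) (conjNE f)) (conjNE f).
Proof.
split; last by apply: derivable_map (proves_refl _) => A; exact: D_tensdup.
apply/(derivable_foldr_And (fun i : N => lit (val i) (f i))); split.
  apply: derivable_tens_NE (proves_refl _); exact: conjNE_proves_NE.
move=> i _; apply: (@derivable_tensE _ set0 (conjNE f) (conjNE f)) => //.
- exact: classical_lit.
- exact: derivable_ax.
- by rewrite set0U; exact: conjNE_proves_lit.
- by rewrite set0U; exact: conjNE_proves_lit.
Qed.

Lemma Theta_absorb f X : f \in X ->
  interderivable (Tens (conjNE f) (Theta X)) (Theta X).
Proof. by move=> fX; apply: bigTens_absorb conjNE_idem _ _ _; rewrite mem_enum. Qed.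

Lemma ThetaU X Y : interderivable (Tens (Theta X) (Theta Y)) (Theta (X :|: Y)).
Proof.
rewrite -bigTens_cat -map_cat; apply: bigTens_eq_mem conjNE_idem _ _ _ => f.
by rewrite mem_cat !mem_enum finset.inE.
Qed.

Lemma Theta_set0 : Theta (finset.set0 : {set {ffun N -> bool}}) = Bot.
Proof. by rewrite /Theta enum_set0. Qed.

Lemma Theta_proves_NE X : X <> finset.set0 -> proves (Theta X) NE.
Proof.
move/eqP/set0Pn => [f fX]; apply: derivable_tens_NE (conjNE_proves_NE f) _.
exact: (Theta_absorb fX).2.
Qed.

(** A copy of the component [conjNE f] is split off; the classical [alpha] may be used inside it and
    turns it into [BotNE], which collapses the tensor. *)
Lemma Theta_contra f X alpha : f \in X -> classical alpha ->
  derivable [set alpha; conjNE f] Bot ->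
  derivable [set alpha; Theta X] BotNE.
Proof.
move=> fX ca d; apply: derivable_map (fun A => @D_tensBotNE A (Theta X)) _.
apply: (@derivable_tens_sub _ [set alpha] (Theta X) (conjNE f)).
- by move=> _ ->.
- exact: subsetUl.
- apply/derivable_tensC/(derivable_proves (Theta_absorb fX).2).
  by apply: derivable_ax; right.
apply: derivable_andI d _; apply: derivable_proves (conjNE_proves_NE f) _.
by apply: derivable_ax; right.
Qed.

(* The excluded-middle formula stands for truth, so that the conjunction is
   classical also when [N] is empty. *)
Definition conj_lits f : form :=
  foldr And (Tens (Var 0) (NegVar 0)) [seq lit (val i) (f i) | i : N].

Lemma classical_conj_lits f : classical (conj_lits f).
Proof.
rewrite /conj_lits /image_mem.
by elim: (enum _) => //= i l ->; rewrite classical_lit.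
Qed.

Lemma conj_lits_proves_lit f (i : N) : proves (conj_lits f) (lit (val i) (f i)).
Proof.
have [/(_ (proves_refl (conj_lits f))) [_ h] _] :=
  derivable_foldr_And (fun i : N => lit (val i) (f i)) [set conj_lits f]
    (Tens (Var 0) (NegVar 0)) (enum {: N}).
by apply: h; rewrite mem_enum.
Qed.

Lemma bigTens_conj_lits G :
  derivable G (bigTens [seq conj_lits f | f : {ffun N -> bool}]).
Proof.
(* [G] may contain non-classical formulas, so the case distinction is carried out in the empty
   context. *)
apply: (@derivable_weak set0) => //.
apply: (@derivable_literal_cases _ (map val (enum {: N}))) => //.
- exact/classical_bigTens/classical_conj_lits.
- by rewrite map_inj_uniq ?enum_uniq //; exact: val_inj.
move=> v; pose f : {ffun N -> bool} := [ffun i => v (val i)].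
apply: (@derivable_proves _ (conj_lits f)).
  apply: bigTensI; last by rewrite mem_enum.
  by move=> g; exact/classical_NE_free/classical_conj_lits.
apply/(derivable_foldr_And (fun i : N => lit (val i) (f i))); split.
  exact: derivable_thm (D_exclmid 0).
move=> i _; apply: derivable_ax; right; exists (val i); last by rewrite ffunE.
by rewrite /= map_f // mem_enum.
Qed.

(** The empty team is split off first, since the distribution rule requires [NE] and yields only
    nonempty index sets. *)
Lemma derivable_Theta_cases G chi :
  (forall X, derivable (G `|` [set Theta X]) chi) -> derivable G chi.
Proof.
move=> h; apply: derivable_Bot_NE.
  by have := h finset.set0; rewrite Theta_set0.
have : derivable (G `|` [set NE])
    (And NE (bigTens [seq conj_lits f | f : {ffun N -> bool}])).
  by apply: derivable_andI (bigTens_conj_lits _); apply: derivable_ax; right.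
(* The tensor is indexed by the functions on [N], so the selected index set [J] is itself a finite
   team. *)
move/(derivable_map (fun A => @D_NEtens A _ conj_lits))/bigOrE; apply => J _.
apply: (@derivable_cut _ (Theta J)).
  apply: derivable_proves (derivable_ax (or_intror erefl)).
  apply: proves_bigTens => f.
  apply/(derivable_foldr_And (fun i : N => lit (val i) (f i))); split.
    exact: derivable_andEl (proves_refl _).
  move=> i _; apply: derivable_proves (conj_lits_proves_lit f i) _.
  exact: derivable_andEr (proves_refl _).
by apply: derivable_weak (h J) => x [Gx|->]; [left; left; left|right].
Qed.

(** * Normal forms *)

Definition models (phi : form) : seq {set {ffun N -> bool}} :=
  [seq X <- enum {set {ffun N -> bool}} | `[< sat (team_of X) phi >]].

Lemma mem_models X phi : X \in models phi <-> sat (team_of X) phi.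
Proof. by rewrite mem_filter mem_enum andbT; split=> /asboolP. Qed.

Definition normal_form (phi : form) : form := bigOr (map (@Theta N) (models phi)).

Lemma derivable_normal_form G X phi :
  sat (team_of X) phi -> derivable G (Theta X) -> derivable G (normal_form phi).
Proof. by move=> /mem_models h; apply: derivable_proves; exact: bigOrI. Qed.

(** Used for the atomic formulas: after case distinction over all teams, only those violating [phi]
    remain to be excluded. *)
Lemma proves_normal_form_by_refutation phi :
  (forall X, ~ sat (team_of X) phi -> derivable [set phi; Theta X] BotNE) ->
  proves phi (normal_form phi).
Proof.
move=> h; apply: derivable_Theta_cases => X.
have [sX|nsX] := EM (sat (team_of X) phi); last exact/derivable_exfalso/h.
by apply: derivable_normal_form sX _; apply: derivable_ax; right.
Qed.

(** A team violating the literal has a member [f] with the opposite value at [i], and the component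
    [conjNE f] contradicts the literal. *)
Lemma lit_normal_form i b : i \in N -> proves (lit i b) (normal_form (lit i b)).
Proof.
move=> iN; pose j : N := [` iN]%fset; apply: proves_normal_form_by_refutation => X.
rewrite sat_lit => /existsNP[s /not_implyP[[f /= fX <-]]].
rewrite -[i]/(val j) extendE => fj; apply: (Theta_contra fX (classical_lit _ _)).
have d1 : derivable [set lit (val j) b; conjNE f] (lit (val j) b).
  by apply: derivable_ax; left.
have d2 : derivable [set lit (val j) b; conjNE f] (lit (val j) (f j)).
  by apply: derivable_proves (conjNE_proves_lit f j) _; apply: derivable_ax; right.
move: fj d1 d2; case: b; case: (f j) => //= _ d1 d2.
  exact: derivable_lits_contra d1 d2.
exact: derivable_lits_contra d2 d1.
Qed.

Lemma proves_normal_form phi : (vars phi `<=` N)%fset -> proves phi (normal_form phi).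
Proof.
elim: phi => /= [i|i|||a IHa b IHb|a IHa b IHb|a IHa b IHb];
  rewrite ?fsub1set ?fsubUset.
- exact: (@lit_normal_form i true).
- exact: (@lit_normal_form i false).
- move=> _; apply: proves_normal_form_by_refutation => X /=.
  rewrite team_of_eq0 => /eqP/set0Pn[f fX]; apply: (Theta_contra fX) => //.
  by apply: derivable_ax; left.
(* Only the empty team violates [NE], and its [Theta] is [Bot]. *)
- move=> _; apply: proves_normal_form_by_refutation => X /= /contrapT/team_of_eq0->.
  by rewrite Theta_set0; apply: derivable_andI; apply: derivable_ax; [right|left].
- move=> /andP[/IHa ha /IHb hb].
  apply: (bigOrE (derivable_proves ha (derivable_andEl (proves_refl (And a b))))).
  move=> X /mem_models sX.
  have := derivable_proves hb (derivable_andEr (proves_refl (And a b))).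
  move/(derivable_weak (@subsetUl _ _ [set Theta X]))/bigOrE; apply => Y /mem_models sY.
  have dX : derivable ([set And a b] `|` [set Theta X] `|` [set Theta Y]) (Theta X).
    by apply: derivable_ax; left; right.
  (* Only the diagonal survives: distinct teams have contradictory descriptions by [D_Theta]. *)
  have [e|nXY] := eqVneq X Y.
    by subst Y; apply: derivable_normal_form dX.
  apply/derivable_exfalso/(derivable_map (fun A => D_Theta (elimN eqP nXY))).
  by apply: derivable_andI dX _; apply: derivable_ax; right.
(* Distributing over both normal forms leaves tensors of two descriptions, each of which describes
   the union of the two teams. *)
- move=> /andP[/IHa ha /IHb hb]; apply: proves_trans (proves_tens ha hb) _.
  apply: bigOr_tensE => Y /mem_models sY.
  apply: proves_trans (interderivable_tensC _ _).1 _.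
  apply: bigOr_tensE => X /mem_models sX.
  apply: proves_trans (interderivable_tensC _ _).1 _.
  apply: (@derivable_normal_form _ (X :|: Y)); last exact: (ThetaU X Y).1.
  exists (team_of X), (team_of Y); rewrite team_ofU.
  by split.
- move=> /andP[/IHa ha /IHb hb].
  apply: (derivable_orE (proves_refl (Or a b))).
  + apply: (bigOrE (derivable_weakr _ ha)) => X /mem_models sX.
    by apply: (@derivable_normal_form _ X); [left|apply: derivable_ax; right].
  + apply: (bigOrE (derivable_weakr _ hb)) => X /mem_models sX.
    by apply: (@derivable_normal_form _ X); [right|apply: derivable_ax; right].
Qed.

(** Every component of [Theta X] proves the literal, which is classical and hence survives tensor
    elimination. *)
Lemma Theta_proves_lit i b X : i \in N ->
  sat (team_of X) (lit i b) -> proves (Theta X) (lit i b).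
Proof.
move=> iN; pose j : N := [` iN]%fset; rewrite sat_lit => sX.
apply: bigTensE => [||f]; first exact: classical_lit.
  exact/classical_NE_free/classical_lit.
rewrite mem_enum => /team_ofP/sX <-.
by rewrite -[i]/(val j) extendE; exact: conjNE_proves_lit.
Qed.

Lemma Theta_proves phi X : (vars phi `<=` N)%fset ->
  sat (team_of X) phi -> proves (Theta X) phi.
Proof.
elim: phi X => /= [i|i|||a IHa b IHb|a IHa b IHb|a IHa b IHb] X;
  rewrite ?fsub1set ?fsubUset.
- exact: (@Theta_proves_lit i true).
- exact: (@Theta_proves_lit i false).
- by move=> _ /team_of_eq0 ->; rewrite Theta_set0; exact: proves_refl.
- by move=> _ nX; apply: Theta_proves_NE => /team_of_eq0.
- by move=> /andP[va vb] [/(IHa _ va) ha /(IHb _ vb) hb]; exact: derivable_andI.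
- move=> /andP[va vb] [_ [_ [/team_of_subset[Y <-] /team_of_subset[Z <-] e sY sZ]]].
  (* Since [team_of] respects unions and reflects membership, the semantic splitting is a splitting
     of [X] itself. *)
  have -> : X = Y :|: Z.
    by apply/setP => f; apply/idP/idP => /team_ofP h; apply/team_ofP; move: h;
      rewrite e team_ofU.
  by apply: proves_trans (ThetaU Y Z).2 _; apply: proves_tens; [exact: IHa|exact: IHb].
- move=> /andP[va vb] [/(IHa _ va) h|/(IHb _ vb) h].
    by apply: derivable_map h => A; exact: D_orIl.
  by apply: derivable_map h => A; exact: D_orIr.
Qed.

End FiniteTeams.

(** * Completeness *)

Lemma entails_proves phi psi : entails psi phi -> proves psi phi.
Proof.
(* With the variables of both formulas in [N], the same [Theta X] serves as a disjunct of [psi] and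
   as a premise for [phi]. *)
move=> h; pose N := (vars psi `|` vars phi)%fset.
apply: (bigOrE (@proves_normal_form N psi (fsubsetUl _ _))) => X /mem_models/h sX.
exact: derivable_weakr _ (Theta_proves (fsubsetUr _ _) sX).
Qed.

Theorem theorem5p6 (phi psi : form) :
  (entails psi phi -> derivable [set psi] phi) /\
  (valid phi -> derivable set0 phi).
Proof.
split; first exact: entails_proves.
(* An axiom serves as the premise of an entailment and is then discharged by its own derivation; the
   index 0 is arbitrary. *)
move=> v; apply: (@derivable_proves _ (Tens (Var 0) (NegVar 0))).
  by apply: entails_proves => X _; exact: v.
exact: derivable_thm (D_exclmid 0).
Qed.
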